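(* For all $n\ge1$, the polynomial $\Psi_{C_n}(t)$ has only real roots.
   Context: $\mathfrak{B}_n$ is the group of bijections $w$ of $[\![n]\!] := \{-n,\dots,-1,1,\dots,n\}$ with $w(-i)=-w(i)$; $\bar i := -i$, $w_i := w(i)$. $X_n := \{w \in \mathfrak{B}_n \mid w^{-1}(1) > 0\}$. Order $[\![n]\!]$ by $\bar n < \dots < \bar 1 < 1 < \dots < n$; write $a \ll b$ if some $c \in [\![n]\!]$ satisfies $a<c<b$. $w$ has a big ascent at $\bar1$ iff $w_1 \ge 2$; at $i\in\{1,\dots,n-1\}$ iff $w_i \ll w_{i+1}$; at $n$ iff $w_n \le \bar 2$; $\operatorname{basc}(w)$ is the number of big ascents. $\Psi_{C_n}(t) := \sum_{w\in X_n} t^{\operatorname{basc}(w)}$ (equivalently, the Ehrhart $h^*$-polynomial of $\Pi_{C_n} := \{x \in \mathbb{R}^n \mid 0 \le 2x_1 \le 1,\ 0 \le x_i - x_{i-1} \le 1\}$ with respect to $\tfrac12\mathbb{Z}^n$). *)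

(* Defs.v *)
From HB Require Import structures.
From mathcomp Require Import all_boot all_order all_fingroup all_algebra.

Set Implicit Arguments.
Unset Strict Implicit.
Unset Printing Implicit Defensive.

Import Order.TTheory GRing.Theory Num.Theory.

Local Open Scope ring_scope.

(* The set {-n, ..., -1, 1, ..., n}: the pair (b, k) stands for the integer
   k + 1 if b is false and for -(k + 1) if b is true; see sint_inj and
   sint_codom. *)
Definition sgn_ord (n : nat) : finType := (bool * 'I_n)%type.

Definition sint (n : nat) (x : sgn_ord n) : int :=
  (-1) ^+ x.1 * (x.2.+1)%:Z.

Definition sopp (n : nat) (x : sgn_ord n) : sgn_ord n := (~~ x.1, x.2).

Lemma sint_opp (n : nat) (x : sgn_ord n) : sint (sopp x) = - sint x.
Proof. by case: x => [[] k]; rewrite /sint /= ?expr0 ?expr1 ?mulN1r ?mul1r ?opprK. Qed.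

Lemma sint_inj (n : nat) : injective (@sint n).
Proof.
move=> [b k] [c l]; rewrite /sint /= => e.
have ekl : k = l.
  apply/val_inj/succn_inj.
  by move/(congr1 absz): e; rewrite !abszMsign.
move: e; rewrite ekl => /(mulIf _) e; congr (_, _).
by have := e isT; case: b c {e} => [] [].
Qed.

Lemma sint_codom (n : nat) (m : int) :
  (exists x : sgn_ord n, sint x = m) <-> (m != 0) && (`|m| <= n%:Z).
Proof.
split=> [[[b k] <-]|].
  rewrite /sint mulf_eq0 signr_eq0 normrMsign /=; exact: ltn_ord.
case: m => [[|k]|k] //=.
- by move=> lt_kn; exists (false, Ordinal (lt_kn : (k < n)%N)); rewrite /sint mul1r.
by move=> lt_kn; exists (true, Ordinal (lt_kn : (k < n)%N)); rewrite /sint mulN1r.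
Qed.

Definition signed_perms (n : nat) : {set {perm sgn_ord n}} :=
  [set w : {perm sgn_ord n} | [forall x, w (sopp x) == sopp (w x)]].

Lemma signed_perms_group_set (n : nat) : group_set (signed_perms n).
Proof.
apply/group_setP; split=> [|u v]; first by rewrite inE; apply/forallP=> x; rewrite !perm1.
rewrite !inE => /forallP hu /forallP hv; apply/forallP=> x.
by rewrite !permM (eqP (hu x)) (eqP (hv _)).
Qed.

Canonical signed_perms_group (n : nat) := Group (signed_perms_group_set n).

(* The relation a << b; since 0 is not available as c, it fails for
   a = -1, b = 1. *)
Definition muchless (n : nat) (a b : sgn_ord n) : bool :=
  [exists c : sgn_ord n, (sint a < sint c) && (sint c < sint b)].

(* p is the position of the ascent: -1, or i with 1 <= i <= n - 1 (then
   q = i + 1), or n. *)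
Definition big_ascent (n : nat) (w : {perm sgn_ord n}) (p : sgn_ord n) : bool :=
  [|| (sint p == -1) && (2 <= sint (w (sopp p))),
      (1 <= sint p) &&
        [exists q, (sint q == sint p + 1) && muchless (w p) (w q)]
    | (sint p == n%:Z) && (sint (w p) <= -2)].

Definition basc (n : nat) (w : {perm sgn_ord n}) : nat :=
  #|[set p | big_ascent w p]|.

(* The condition w^-1(1) > 0; the element p with sint p = 1 exists, and is
   unique, as soon as n >= 1. *)
Definition Xset (n : nat) : {set {perm sgn_ord n}} :=
  [set w in signed_perms n |
    [exists p, (sint p == 1) && (0 < sint ((w^-1)%g p))]].

Definition PsiC (n : nat) : {poly int} := \sum_(w in Xset n) 'X^(basc w).

(* All roots in an algebraically closed field C with conjugation are real;
   C can be the complex numbers R[i] over any real closed field R. *)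
Definition only_real_roots (p : {poly int}) : Prop :=
  forall (C : numClosedFieldType) (z : C),
    root (map_poly intr p) z -> z \is Num.real.

(* Main.v *)
Require Import Defs.
From mathcomp Require Import all_boot all_order all_fingroup all_algebra.
From mathcomp Require Import zify ring.

(* Read w as the word -1, w_1, ..., w_n, 1: the big ascents of w are the
   consecutive pairs a << b of this word.  Inserting n+1 or -(n+1) between a
   and b keeps the number of big ascents when a << b, and otherwise increases
   it by one except when n+1 follows n or -(n+1) precedes -n; exactly one of
   these two exceptional insertions exists.  Hence
     Psi_(n+1) = 2 t (1 - t) Psi_n' + (1 + (2n + 1) t) Psi_n.
   If all roots of P are real, hence nonpositive when P is positive on the
   positive axis, then Im (z P'(z) / P(z)) and Im z do not have opposite signs.
   At a nonreal zero z of the right-hand side,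
     z P'(z) / P(z) = - 1/2 - (n + 1) z / (1 - z),
   whose imaginary part has the sign opposite to Im z. *)

Set Implicit Arguments.
Unset Strict Implicit.
Unset Printing Implicit Defensive.

Import Order.TTheory GRing.Theory Num.Theory.

Local Open Scope ring_scope.

(* The relation << on nonzero integers; -1 << 1 fails since 0 is not a letter. *)
Definition far (a b : int) : bool :=
  (a + 1 < b) && ~~ ((a == -1) && (b == 1)).

(* The pairs counted are those of the word a, s, 1: the final 1 is implicit. *)
Fixpoint nfar (a : int) (s : seq int) : nat :=
  if s is b :: s' then (far a b + nfar b s')%N else far a 1.

(** * Generating words by insertion of a largest letter *)

Fixpoint ins (e : int) (s : seq int) : seq (seq int) :=
  [:: e :: s, - e :: s &
    if s is b :: s' then [seq b :: r | r <- ins e s'] else [::]].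

(* Words of length m + 1: the letter inserted at stage m is m + 1. *)
Fixpoint words (m : nat) : seq (seq int) :=
  if m is m'.+1 then [seq r | s <- words m', r <- ins m.+1%:Z s]
  else [:: [:: 1]].

Lemma insP (e : int) (s r : seq int) :
  reflect (exists s1 s2 x, [/\ s = s1 ++ s2, r = s1 ++ x :: s2
                            & (x == e) || (x == - e)])
          (r \in ins e s).
Proof.
apply: (iffP idP) => [|[s1 [s2 [x [-> -> {s r}]]]]].
  elim: s r => [|b s IHs] r /=; rewrite !inE.
    by case/orP=> /eqP ->; [exists [::], [::], e|exists [::], [::], (- e)];
      rewrite eqxx ?orbT.
  case/or3P=> [/eqP ->|/eqP ->|/mapP [r' /IHs [s1 [s2 [x [-> -> xe]]]] ->]].
  - by exists [::], (b :: s), e; rewrite eqxx.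
  - by exists [::], (b :: s), (- e); rewrite eqxx orbT.
  by exists (b :: s1), s2, x.
elim: s1 => [|b s1 IHs] xe /=; last by rewrite !inE map_f ?orbT ?IHs.
by case/orP: xe => /eqP ->; case: s2 => *; rewrite /= !inE eqxx ?orbT.
Qed.

(** Neither [e] nor [- e] occurs in [s], so the first difference from [s] reveals both the slot and
    the sign. *)
Lemma uniq_ins (e : int) (s : seq int) :
  e != 0 -> e \notin s -> - e \notin s -> uniq (ins e s).
Proof.
move=> e0; elim: s => [|b s IHs] /=; rewrite ?inE.
  by move=> _ _; rewrite andbT eqseq_cons eqxx andbT; lia.
rewrite !negb_or => /andP [eb es] /andP [neb nes].
rewrite map_inj_uniq ?IHs // ?andbT; last by move=> ? ? [].
have nin x (t : seq int) l : x != b -> x :: t \notin [seq b :: r | r <- l].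
  by move=> xb; apply/mapP => -[r _ [/eqP]]; rewrite (negbTE xb).
by rewrite !nin // eqseq_cons eqxx !andbT; lia.
Qed.

(** Having the letter 1, not -1, encodes the condition w^-1(1) > 0. *)
Definition is_word (m : nat) (s : seq int) : bool :=
  perm_eq (map absz s) (iota 1 m.+1) && (1 \in s).

Lemma perm_iotaS (m : nat) (s1 s2 : seq nat) :
  perm_eq (s1 ++ m.+2 :: s2) (iota 1 m.+2) = perm_eq (s1 ++ s2) (iota 1 m.+1).
Proof.
have /permPr -> : perm_eq (iota 1 m.+2) (m.+2 :: iota 1 m.+1).
  by rewrite -[X in iota 1 X]addn1 iotaD cats1 perm_rcons add1n.
by rewrite -cat1s perm_catCA /= perm_cons.
Qed.

(** Insertion is undone by deleting the letter of absolute value m + 2, which is never the letter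
    1. *)
Lemma mem_words (m : nat) (s : seq int) : (s \in words m) = is_word m s.
Proof.
elim: m s => [|m IHm] s /=.
  rewrite inE /is_word; apply/eqP/andP => [->|[/perm_size]] //=.
  by case: s => [|a [|]] //= _; rewrite inE => /eqP <-.
have absE x : (x == m.+2%:Z) || (x == - m.+2%:Z) = (absz x == m.+2) by lia.
apply/allpairsPdep/idP => [[s' [r []]]|].
  rewrite IHm => /andP [ps' one] /insP [s1 [s2 [x [es' -> xe]]]] ->.
  move: ps' one; rewrite absE in xe; rewrite /is_word es' !map_cat /= (eqP xe).
  by rewrite perm_iotaS => -> /=; rewrite !mem_cat inE orbCA => ->; rewrite orbT.
case/andP=> ps one.
have : m.+2 \in map absz s by rewrite (perm_mem ps) mem_iota; lia.
case/mapP=> x /splitPr xs; case: xs ps one => s1 s2 ps one xm.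
exists (s1 ++ s2), (s1 ++ x :: s2); split=> //; last first.
  by apply/insP; exists s1, s2, x; rewrite absE -xm.
rewrite IHm; move: ps; rewrite /is_word !map_cat /= -xm perm_iotaS => -> /=.
by move: one; rewrite !mem_cat inE orbCA => /orP [/eqP x1|//]; lia.
Qed.

Lemma is_word_bound m s x : is_word m s -> x \in s -> (0 < absz x <= m.+1)%N.
Proof.
by case/andP=> ps _ xs; have := map_f absz xs; rewrite (perm_mem ps) mem_iota; lia.
Qed.

Lemma uniq_words (m : nat) : uniq (words m).
Proof.
elim: m => // m IHm; apply: allpairs_uniq_dep => // [s|[s r] [s' r']].
  rewrite mem_words => ws; apply: uniq_ins => //;
  by apply/negP => /(is_word_bound ws); lia.
(* Filtering out the new letter recovers the parent word, so distinct parents have disjoint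
   offspring. *)
have del t u : t \in words m -> u \in ins m.+2%:Z t ->
    [seq x <- u | (absz x < m.+2)%N] = t.
  rewrite mem_words => wt /insP [t1 [t2 [x [et -> xe]]]].
  rewrite filter_cat /= ifN; last by lia.
  rewrite -filter_cat -et; apply/all_filterP/allP => y /(is_word_bound wt); lia.
move=> /allpairsPdep [t [u [tw uw ->]]] /allpairsPdep [t' [u' [tw' uw' ->]]] /= e.
by subst u'; have := del _ _ tw' uw'; rewrite (del _ _ tw uw) => <-.
Qed.

(** * Big ascents read off words *)

Definition word (n : nat) (w : {perm sgn_ord n}) : seq int :=
  [seq sint (w (false, i)) | i <- enum 'I_n].

Lemma nth_word (m : nat) (w : {perm sgn_ord m.+1}) d (i : 'I_m.+1) :
  nth d (word w) i = sint (w (false, i)).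
Proof. by rewrite (nth_map ord0) ?size_enum_ord // nth_ord_enum. Qed.

Lemma size_word (n : nat) (w : {perm sgn_ord n}) : size (word w) = n.
Proof. by rewrite size_map size_enum_ord. Qed.

(** The default [1] of the second [nth] supplies the implicit final letter. *)
Lemma nfar_sum (a : int) (s : seq int) :
  nfar a s = (\sum_(i < (size s).+1) far (nth 0%R (a :: s) i) (nth 1%R s i))%N.
Proof.
elim: s a => [|b s IHs] a /=; first by rewrite big_ord_recl big_ord0 addn0.
by rewrite IHs [RHS]big_ord_recl.
Qed.

Lemma muchlessE (n : nat) (a b : sgn_ord n) : muchless a b = far (sint a) (sint b).
Proof.
have bnd (x : sgn_ord n) : (sint x != 0) && (`|sint x| <= n%:Z).
  by apply/sint_codom; exists x.
have := bnd a; have := bnd b; rewrite /far => ba bb.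
apply/existsP/idP => [[c]|]; first by have := bnd c; lia.
move=> ab.
(* The witness is the successor of [a], which skips the missing 0. *)
have [c cE] : exists c : sgn_ord n, sint c = if sint a == -1 then 1 else sint a + 1.
  by apply/sint_codom; case: ifP => /eqP; lia.
by exists c; rewrite cE; case: ifP => /eqP; lia.
Qed.

Lemma sint_true (n : nat) (i : 'I_n) : sint (true, i) = - (i.+1)%:Z.
Proof. by rewrite /sint /= expr1 mulN1r. Qed.

Lemma sint_false (n : nat) (i : 'I_n) : sint (false, i) = (i.+1)%:Z.
Proof. by rewrite /sint /= expr0 mul1r. Qed.

(** Position -1 yields the pair (-1, w_1), position i < n the pair (w_i, w_(i+1)), and position n
    the pair (w_n, 1). *)
Lemma basc_word (m : nat) (w : {perm sgn_ord m.+1}) : basc w = nfar (-1) (word w).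
Proof.
rewrite nfar_sum size_word /basc -sum1dep_card big_mkcond /=.
transitivity (\sum_(b : bool) \sum_(i < m.+1) big_ascent w (b, i))%N.
  by rewrite pair_bigA; apply: eq_bigr => -[b i] _ /=; case: ifP.
(* Negative positions below -1 contribute nothing. *)
have neg0 : (\sum_(i < m) big_ascent w (true, lift ord0 i) = 0)%N.
  apply: big1 => i _; suff /negbTE -> : ~~ big_ascent w (true, lift ord0 i) by [].
  by apply/negP; rewrite /big_ascent sint_true lift0; lia.
rewrite big_bool /= big_ord_recl [in RHS]big_ord_recl neg0 addn0.
congr addn.
  rewrite [nth 0 _ _]/= (nth_word _ 1 ord0) /big_ascent sint_true /far.
  by rewrite -[sopp _]/(false, ord0) -[nat_of_ord ord0]/0%N; congr nat_of_bool; lia.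
apply: eq_bigr => i _; rewrite lift0 [nth 0 _ _]/= (nth_word _ 0 i).
rewrite /big_ascent sint_false.
set E := [exists q, _].
(* At the last position no [q] exists; the third clause of [big_ascent] matches the default letter
   1. *)
have [im|im] := ltnP i m; last first.
  have im' : i.+1 = m.+1 by have := ltn_ord i; lia.
  have -> : E = false.
    apply/existsP => -[q /andP [/eqP qE _]].
    have : (sint q != 0) && (`|sint q| <= m.+1%:Z) by apply/sint_codom; exists q.
    lia.
  have : (sint (w (false, i)) != 0) && (`|sint (w (false, i))| <= m.+1%:Z).
    by apply/sint_codom; exists (w (false, i)).
  by rewrite nth_default ?size_word ?im' // /far; lia.
pose j : 'I_m.+1 := Ordinal (im : i.+1 < m.+1)%N.
have -> : E = far (sint (w (false, i))) (sint (w (false, j))).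
  rewrite -muchlessE; apply/existsP/idP => [[q /andP [/eqP qE]]|mu].
    suff -> : q = (false, j) by [].
    by apply: sint_inj; rewrite qE sint_false /=; lia.
  by exists (false, j); rewrite mu sint_false /= andbT; lia.
by rewrite (nth_word _ 1 j); congr nat_of_bool; lia.
Qed.

(** * The recurrence *)

Lemma nfar_nil (a : int) : nfar a [::] = far a 1.
Proof. by []. Qed.

Lemma nfar_cons (a b : int) (s : seq int) :
  nfar a (b :: s) = (far a b + nfar b s)%N.
Proof. by []. Qed.

(** Here [e] counts the exceptional insertions: after a letter n, possibly [a] itself, or before a
    letter -n of [s]. The [2 * k] insertions into far pairs and these [e] ones keep the count; all
    others raise it by one. The induction on [s] lets [a] vary. *)
Lemma sum_ins (n : nat) (a : int) (s : seq int) :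
    (0 < n)%N -> all (fun x => 0 < absz x <= n)%N (a :: s) ->
  let k := nfar a s in
  let e := (count_mem n%:Z (a :: s) + count_mem (- n%:Z) s)%N in
  \sum_(r <- ins n.+1%:Z s) 'X^(nfar a r) =
    (2 * k + e)%N%:R * 'X^k
    + ((2 * (size s).+1)%N%:R - (2 * k + e)%N%:R) * 'X^(k.+1)
  :> {poly int}.
Proof.
move=> n_gt0 /=; elim: s a => [|b s IHs] a /andP [an sn] /=.
  rewrite !big_cons big_nil addr0 !nfar_cons !nfar_nil.
  have -> : far a n.+1%:Z = (a != n%:Z) by rewrite /far; lia.
  have -> : far n.+1%:Z 1 = false by rewrite /far; lia.
  have -> : far a (- n.+1%:Z) = false by rewrite /far; lia.
  have -> : far (- n.+1%:Z) 1 = true by rewrite /far; lia.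
  have : far a 1 -> a != n%:Z by rewrite /far; lia.
  by case: (far a 1); case: (a =P n%:Z) => _ //= H; try (by have := H isT); ring.
have bn : (0 < absz b <= n)%N by case/andP: sn.
rewrite /= !big_cons big_map !nfar_cons.
under eq_bigr => r _ do rewrite nfar_cons exprD.
rewrite -mulr_sumr IHs //.
have -> : far a n.+1%:Z = (a != n%:Z) by rewrite /far; lia.
have -> : far n.+1%:Z b = false by rewrite /far; lia.
have -> : far a (- n.+1%:Z) = false by rewrite /far; lia.
have -> : far (- n.+1%:Z) b = (b != - n%:Z) by rewrite /far; lia.
(* A far pair never hosts an exceptional insertion, so nothing is counted twice. *)
have : far a b -> (a != n%:Z) && (b != - n%:Z) by rewrite /far; lia.
rewrite /=; set k := nfar b s; set c1 := count _ s; set c2 := count _ s.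
rewrite !add0n !exprS !exprD !natrD !natrM.
by case: (far a b); case: (a =P n%:Z) => _; case: (b =P - n%:Z) => _ //= H;
  try (by have := H isT); case: (b =P n%:Z) => _ /=; ring.
Qed.

Definition step (n : nat) (p : {poly int}) : {poly int} :=
  2%:R * 'X * (1 - 'X) * p^`() + (1 + (2 * n + 1)%N%:R * 'X) * p.

(** This is the right-hand side of [sum_ins] with [e = 1] and [size s = n]; linearity of [step] then
    gives the recurrence. *)
Lemma stepXn (n k : nat) :
  step n 'X^k =
    (2 * k + 1)%N%:R * 'X^k + ((2 * n.+1)%N%:R - (2 * k + 1)%N%:R) * 'X^(k.+1).
Proof.
by rewrite /step derivXn -mulr_natr; case: k => [|k] /=; rewrite ?exprS; ring.
Qed.

Lemma count_extreme (m : nat) (s : seq int) : is_word m s ->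
  (count_mem m.+1%:Z s + count_mem (- m.+1%:Z) s = 1)%N.
Proof.
case/andP=> ps _; have /seq.permP /(_ (pred1 m.+1)) := ps.
rewrite count_map [RHS]count_uniq_mem ?iota_uniq // mem_iota ltnS leqnn /= => <-.
rewrite -count_predUI [X in (_ + X)%N](eq_count (a2 := pred0)) ?count_pred0 ?addn0.
  by apply: eq_count => x /=; lia.
by move=> x /=; lia.
Qed.

Lemma sum_words_step (m : nat) :
  \sum_(s <- words m.+1) 'X^(nfar (-1) s)
  = step m.+1 (\sum_(s <- words m) 'X^(nfar (-1) s)).
Proof.
rewrite /= big_allpairs_dep /= /step raddf_sum /= !mulr_sumr -big_split /=.
apply: eq_big_seq => s; rewrite mem_words => ws.
have /andP [/perm_size] := ws; rewrite size_map size_iota => ss _.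
rewrite -[RHS]/(step _ _) stepXn sum_ins //= => [|].
  by rewrite add0n count_extreme // ss.
by apply/allP => x /(is_word_bound ws).
Qed.

(** * Bijection between [Xset] and words *)

Lemma absz_sint (n : nat) (x : sgn_ord n) : absz (sint x) = x.2.+1.
Proof. by rewrite /sint abszMsign. Qed.

Lemma signed_permsP (n : nat) (w : {perm sgn_ord n}) :
  reflect (forall x, w (sopp x) = sopp (w x)) (w \in signed_perms n).
Proof.
by rewrite inE; apply: (iffP forallP) => h x; [apply/eqP | apply/eqP].
Qed.

Lemma word_inj (m : nat) : {in Xset m.+1 &, injective (@word m.+1)}.
Proof.
move=> u v; rewrite !inE => /andP [/forallP su _] /andP [/forallP sv _] e.
have pos i : u (false, i) = v (false, i).
  by apply: sint_inj; rewrite -!(nth_word _ 0) e.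
apply/permP => -[[] i] //.
by rewrite -[(true, i)]/(sopp (false, i)) (eqP (su _)) (eqP (sv _)) pos.
Qed.

Lemma is_word_word (m : nat) (w : {perm sgn_ord m.+1}) :
  w \in Xset m.+1 -> is_word m (word w).
Proof.
rewrite inE => /andP [/signed_permsP sw /existsP [p /andP [/eqP p1 wp]]].
apply/andP; split; last first.
  (* The letter 1 sits at index w^-1(1), whose sign is positive by definition of [Xset]. *)
  apply/mapP; exists ((w^-1)%g p).2; first by rewrite mem_enum.
  case e: ((w^-1)%g p) wp => [[] k] /=; first by rewrite sint_true; lia.
  by move=> _; rewrite -e permKV p1.
(* Equal absolute values mean w_i = w_j or w_i = w_(-j); the latter contradicts injectivity. *)
have uw : uniq (map absz (word w)).
  rewrite -map_comp map_inj_in_uniq ?enum_uniq // => i j _ _ /=.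
  rewrite !absz_sint => -[/val_inj e].
  have [ee|ee] : w (false, i) = w (false, j) \/ w (false, i) = w (true, j).
  - rewrite -[(true, j)]/(sopp (false, j)) sw /sopp.
    by case: (w (false, i)) (w (false, j)) e => [[] k] [[] l] /= ->; auto.
  - by have [] := perm_inj ee.
  by have := perm_inj ee.
have sub : {subset map absz (word w) <= iota 1 m.+1}.
  move=> y /mapP [x /mapP [i _ ->] ->]; rewrite absz_sint mem_iota add1n.
  by rewrite ltnS leq0n /= ltnS ltn_ord.
have [|_ e] := uniq_min_size uw sub; last by apply: uniq_perm; rewrite ?iota_uniq.
by rewrite size_map size_word size_iota.
Qed.

Lemma word_surj (m : nat) (s : seq int) : is_word m s ->
  exists2 w, w \in Xset m.+1 & word w = s.
Proof.
move=> ws; have /andP [ps one] := ws.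
have ss : size s = m.+1 by have /perm_size := ps; rewrite size_map size_iota.
have sb (k : 'I_m.+1) : (0 < absz (s`_k)%R <= m.+1)%N.
  by apply: is_word_bound ws _; rewrite mem_nth ?ss.
(* The odd extension of [s]: signs multiply, and the predecessor appears because index k stands for
   k + 1. *)
pose f (x : sgn_ord m.+1) : sgn_ord m.+1 :=
  (x.1 (+) (s`_(x.2) < 0), inord (absz s`_(x.2)).-1).
have fS (b : bool) (k : 'I_m.+1) : sint (f (b, k)) = (-1) ^+ b * s`_k.
  have := sb k; rewrite /sint /f /=; set x : int := s`_k => sk.
  rewrite inordK; last by lia.
  rewrite signr_addb -mulrA; congr (_ * _).
  by case: (ltrP x 0) => ?; rewrite ?expr0 ?expr1; lia.
have inj_f : injective f.
  move=> [b k] [c l] e; have := fS c l; rewrite -e fS => {}e.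
  have ekl : k = l.
    apply/val_inj; apply: (@uniqP _ 0 (map absz s)) => //=;
      rewrite ?inE ?size_map ?ss //.
    - by rewrite (perm_uniq ps) iota_uniq.
    by rewrite !(nth_map 0) ?ss //; move/(congr1 absz): e; rewrite !abszMsign.
  by subst l; have := sb k; move: e; case: b; case: c;
    rewrite /= ?expr0 ?expr1 // => ? ?; lia.
exists (perm inj_f).
  rewrite inE; apply/andP; split.
    apply/signed_permsP => -[b k]; rewrite !permE /f /sopp /=.
    by rewrite addNb.
  apply/existsP; exists (false, ord0); rewrite sint_false /=.
  have /(nthP 0) [i] := one; rewrite ss => im si.
  suff -> : (perm inj_f)^-1%g (false, ord0) = (false, Ordinal im) by rewrite sint_false.
  apply: (@perm_inj _ (perm inj_f)); rewrite permKV permE.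
  by apply: sint_inj; rewrite fS sint_false /= si.
apply: (@eq_from_nth _ 0); rewrite size_word ?ss // => i im.
by rewrite (nth_word _ _ (Ordinal im)) permE fS expr0 mul1r.
Qed.

Lemma PsiC_words (m : nat) : PsiC m.+1 = \sum_(s <- words m) 'X^(nfar (-1) s).
Proof.
transitivity (\sum_(s <- map (@word m.+1) (enum (Xset m.+1)))
  'X^(nfar (-1) s) : {poly int}).
  by rewrite big_map big_enum; apply: eq_bigr => w _; rewrite basc_word.
apply: perm_big; apply: uniq_perm; rewrite ?uniq_words //.
  rewrite map_inj_in_uniq ?enum_uniq // => u v; rewrite !mem_enum; exact: word_inj.
move=> s; rewrite mem_words; apply/mapP/idP => [[w]|/word_surj [w wX <-]].
  by rewrite mem_enum => /is_word_word ? ->.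
by exists w; rewrite ?mem_enum.
Qed.

(** * Positivity and real roots *)

Lemma Xset_neq0 (m : nat) : Xset m.+1 != set0.
Proof.
apply/set0Pn; exists 1%g; rewrite inE group1; apply/existsP.
by exists (false, ord0); rewrite invg1 perm1 sint_false.
Qed.

Lemma PsiC_gt0 (C : numClosedFieldType) (m : nat) (x : C) :
  0 < x -> 0 < (map_poly intr (PsiC m.+1)).[x].
Proof.
move=> x0; rewrite /PsiC rmorph_sum horner_sum /=.
have [w wX] := set0Pn _ (Xset_neq0 m).
rewrite (bigD1 w) //= ltr_pwDl //; last first.
  by apply: sumr_ge0 => u _; rewrite map_polyXn hornerXn exprn_ge0 // ltW.
by rewrite map_polyXn hornerXn exprn_gt0.
Qed.

Section Roots.

Variable C : numClosedFieldType.
Implicit Types (z r : C) (s : seq C).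

(** Multiplying by the conjugate of z - r turns the numerator into |z|^2 - r z. *)
Lemma Im_divB z r : r \is Num.real -> z \isn't Num.real ->
  'Im (z / (z - r)) = - r * 'Im z / `|z - r| ^+ 2.
Proof.
move=> rR zNR; have zr0 : z - r != 0.
  by apply: contraNneq zNR => /eqP; rewrite subr_eq0 => /eqP ->.
have cz0 : (z - r)^* != 0 by rewrite conjC_eq0.
have -> : z / (z - r) = `|z - r| ^- 2 * (`|z| ^+ 2 + - r * z).
  have -> : `|z| ^+ 2 + - r * z = z * (z - r)^*.
    by rewrite rmorphB /= (CrealP rR) normCK; ring.
  by rewrite normCK; field; rewrite -rmorphB cz0.
have nR (x : C) : `|x| ^+ 2 \is Num.real by rewrite rpredX ?normr_real.
rewrite ImMl ?rpredV // raddfD /= (Creal_ImP _ (nR z)) ImMl ?rpredN //.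
by rewrite add0r mulrC.
Qed.

(** The logarithmic derivative times z is the sum of the z / (z - r), and each -r is nonnegative.
    The factor ['Im z] avoids a case split on its sign. *)
Lemma Im_logderiv_ge0 z s : z \isn't Num.real ->
    (forall r, r \in s -> r <= 0) ->
  let q := \prod_(r <- s) ('X - r%:P) in
  q.[z] != 0 /\ 0 <= 'Im z * 'Im (z * (q^`()).[z] / q.[z]).
Proof.
move=> zNR; elim: s => [|r s IHs] s_le0 /=.
  rewrite big_nil derivC !hornerE oner_eq0; split=> //.
  by rewrite ?(mulr0, mul0r) raddf0 mulr0.
have [|q0 IH] := IHs; first by move=> x xs; apply: s_le0; rewrite inE xs orbT.
have r_le0 : r <= 0 by apply: s_le0; rewrite inE eqxx.
have rR : r \is Num.real by apply: ler0_real.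
have zr0 : z - r != 0.
  by apply: contraNneq zNR => /eqP; rewrite subr_eq0 => /eqP ->.
rewrite big_cons; set q := \prod_(_ <- s) _ in q0 IH *.
rewrite derivM derivXsubC mul1r !hornerE mulf_neq0 //; split=> //.
have -> : z * (q.[z] + (z - r) * q^`().[z]) / ((z - r) * q.[z])
          = z / (z - r) + z * q^`().[z] / q.[z].
  by field; rewrite zr0 q0.
rewrite raddfD /= mulrDr addr_ge0 // Im_divB // mulrA mulrCA -expr2.
rewrite mulr_ge0 ?invr_ge0 ?exprn_ge0 // mulr_ge0 ?oppr_ge0 //.
by rewrite real_exprn_even_ge0 ?Creal_Im.
Qed.

End Roots.

Lemma step_real_roots (n : nat) (p : {poly int}) :
    (forall (C : numClosedFieldType) (x : C),
      0 < x -> 0 < (map_poly intr p).[x]) ->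
  only_real_roots p -> only_real_roots (step n p).
Proof.
move=> p_gt0 p_real C z; rewrite /root.
set P := map_poly intr p : {poly C}.
have -> : (map_poly intr (step n p)).[z] =
    2%:R * z * (1 - z) * P^`().[z] + (1 + (2 * n + 1)%N%:R * z) * P.[z].
  rewrite /step; move: (2 * n + 1)%N 2%N => c d.
  rewrite rmorphD !rmorphM rmorphB rmorphD rmorphM !rmorph1 !rmorph_nat /=.
  by rewrite map_polyX -deriv_map -!polyC_natr !(hornerE, hornerMn).
move=> /eqP Qz; apply: contraT => zNR.
have [s Ps] := closed_field_poly_normal P.
have lc0 : lead_coef P != 0.
  rewrite lead_coef_eq0; apply/eqP => P0.
  by have := p_gt0 C 1 ltr01; rewrite -/P P0 horner0 ltxx.
(* Roots are real by hypothesis, and positivity of [p] excludes positive ones. *)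
have s_le0 r : r \in s -> r <= 0.
  move=> rs; have rootr : root P r by rewrite Ps rootZ // root_prod_XsubC.
  rewrite real_leNgt ?real0 ?(p_real C) //; apply/negP => /p_gt0.
  by rewrite -/P (eqP rootr) ltxx.
have [] := Im_logderiv_ge0 zNR s_le0; set Q := \prod_(_ <- s) _ in Ps *.
move=> Q0 ImL; rewrite Ps derivZ !hornerZ in Qz.
have z1 : z - 1 != 0.
  by apply: contraNneq zNR => /eqP; rewrite subr_eq0 => /eqP ->.
have {}Qz : 2%:R * z * (1 - z) * Q^`().[z] + (1 + (2 * n + 1)%N%:R * z) * Q.[z] = 0.
  by apply: (mulfI lc0); rewrite mulr0 -Qz; ring.
(* Solving [Qz] for the logarithmic derivative isolates z / (z - 1), the case r = 1 of [Im_divB]. *)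
have LE : z * Q^`().[z] / Q.[z] = - 2%:R^-1 + n.+1%:R * (z / (z - 1)).
  have n2 : 2%:R != 0 :> C by rewrite pnatr_eq0.
  apply: (mulIf Q0); rewrite divfK //.
  apply: (mulfI (mulf_neq0 n2 z1)).
  rewrite -[LHS]addr0 -Qz.
  by field; rewrite z1.
have halfR : - 2%:R^-1 \is @Num.real C by rewrite rpredN rpredV realn.
(* Since r = 1 is positive, the sign flips: minus a positive multiple of the square of ['Im z] would
   be nonnegative. *)
move: ImL; rewrite LE raddfD /= (Creal_ImP _ halfR) add0r ImMl ?realn //.
rewrite Im_divB ?real1 // mulN1r mulNr !mulrN oppr_ge0.
rewrite real_leNgt ?real0 //; last first.
  by rewrite !rpredM ?rpredV ?rpredX ?Creal_Im ?normr_real ?realn.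
have Imz0 : 'Im z != 0 by apply: contra zNR => /eqP/Creal_ImP.
have -> : 'Im z * (n.+1%:R * ('Im z / `|z - 1| ^+ 2))
        = n.+1%:R * ('Im z ^+ 2 / `|z - 1| ^+ 2) by rewrite expr2; ring.
rewrite mulr_gt0 ?ltr0Sn // divr_gt0 //; last by rewrite exprn_gt0 ?normr_gt0.
by rewrite real_exprn_even_gt0 ?Creal_Im ?Imz0 ?orbT.
Qed.

Theorem theorem7p5 (n : nat) (hn : (1 <= n)%N) : only_real_roots (PsiC n).
Proof.
case: n hn => // m _; elim: m => [|m IHm].
  (* The only word of length 1 is [[:: 1]], without far pairs, so the polynomial is 1. *)
  rewrite PsiC_words big_seq1 expr0 => C z.
  by rewrite /root rmorph1 hornerC oner_eq0.
rewrite PsiC_words sum_words_step -PsiC_words.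
by apply: step_real_roots IHm => C x; apply: PsiC_gt0.
Qed.
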